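(* Let $r>0$ and, for $h>0$, let $C_{-h}$ and $C_{h}$ be two coaxial Euclidean circles of radius $r$ with respect to the $z$-axis in $\mathbb{R}_1^3$, separated by a distance equal to $2h$, i.e. $C_{\pm h}=\{(x,y,z): x^2+y^2=r^2,\ z=\pm h\}$. Let $N(h)$ denote the number of timelike elliptic catenoids connecting $C_{-h}$ and $C_h$. Then: (1) $N(h)$ is a finite number. (2) $N(h)$ is a non-decreasing function of $h$. (3) $\lim_{h\to\infty}N(h)=\infty$. (4) There exists $c_0>0$ such that if $h/r<c_0$, then $N(h)=1$.
   Context: $\mathbb{R}_1^3$ is $\mathbb{R}^3$ with the metric $dx^2+dy^2-dz^2$. A catenoid is a non-degenerate rotational surface with zero mean curvature everywhere; it is timelike if its induced metric is Lorentzian, and elliptic if its rotation axis is timelike. The timelike elliptic catenoids with axis the $z$-axis are the surfaces $\{(f(s)\cos t,f(s)\sin t,s): s,t\in\mathbb{R}\}$ with $f(s)=\frac1a\sin(as+b)$, $a\neq0$, $b\in\mathbb{R}$. The profile curve is taken over all $s\in\mathbb{R}$ and is allowed to meet the rotation axis (where the surface has a singularity). Such a catenoid connects $C_{-h}$ and $C_h$ if it contains both circles; catenoids are counted as distinct when they are distinct subsets of $\mathbb{R}_1^3$. *)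

(* Defs.v *)
From mathcomp Require Import all_boot all_order all_algebra.
From mathcomp Require Import finmap.
From mathcomp Require Import all_classical all_reals all_analysis.
Set Implicit Arguments.
Unset Strict Implicit.
Unset Printing Implicit Defensive.
Import Order.TTheory GRing.Theory Num.Theory.
Import numFieldNormedType.Exports.
Local Open Scope classical_set_scope.
Local Open Scope ring_scope.

Section TimelikeEllipticCatenoids.
Context {R : realType}.

(* The points (x, y, z) of R_1^3, with metric dx^2 + dy^2 - dz^2. *)
Local Notation space := (R * R * R)%type.

(* The Euclidean circle x^2 + y^2 = r^2 in the plane z = h. *)
Definition circle (r h : R) : set space :=
  [set p | p.1.1 ^+ 2 + p.1.2 ^+ 2 = r ^+ 2 /\ p.2 = h].

(* For a != 0 this f satisfies f f'' = f'^2 - 1, the equation of zero mean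
   curvature for the surface of revolution x^2 + y^2 = f(z)^2, and
   f'^2 < 1 (Lorentzian induced metric) wherever f does not vanish. *)
Definition profile (a b s : R) : R := a^-1 * sin (a * s + b).

(* s ranges over all of R, so the surface contains its singular points on
   the axis, where f vanishes. *)
Definition catenoid (a b : R) : set space :=
  [set (profile a b st.1 * cos st.2, profile a b st.1 * sin st.2, st.1)
     | st in [set: R * R]].

(* Catenoids are subsets of the space: parameters (a, b) with the same image
   give the same catenoid. *)
Definition timelike_elliptic_catenoid (S : set space) : Prop :=
  exists a b : R, a != 0 /\ S = catenoid a b.

Definition connecting_catenoids (r h : R) : set (set space) :=
  [set S | [/\ timelike_elliptic_catenoid S,
               circle r (- h) `<=` S & circle r h `<=` S]].

(* fset_set sends infinite sets to fset0, so this number is meaningful only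
   when connecting_catenoids r h is finite. *)
Definition catenoid_count (r h : R) : nat :=
  #|` fset_set (connecting_catenoids r h)|%fset.

End TimelikeEllipticCatenoids.

(* Main.v *)
(* The catenoid with parameters a > 0, 0 <= b < pi is x^2 + y^2 = f(z)^2, so
   with u = a h and lam = h / r it connects the two circles iff
   sin^2 (b + u) = sin^2 (b - u) = (u / lam)^2, which forces
   sin (2 b) sin (2 u) = 0.
   If b is not 0 or pi/2, then u = k pi / 2 with 0 < u < lam, and each such k
   admits exactly one b in (0, pi/2) and its mirror image pi - b.
   If b is 0 or pi/2, put u + b = k pi + v with 0 < v < pi; then v is a zero of
   lam sin v - (v + k pi - b), which is strictly concave and so has at most two
   zeros.  When lam increases this function increases, so its last zero moves
   right without disappearing, and the other zero, which exists only when
   k pi - b > 0, moves left.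
   Labelling each solution by k, by b (or by the side of pi/2 on which b lies)
   and by whether v is the last zero gives an injective labelling with values
   in a finite set; the set of labels in use grows with lam, contains at least
   one element for every k pi / 2 < lam, and is a singleton when lam < 1. *)
Require Import Defs.
From mathcomp Require Import all_boot all_order all_algebra.
From mathcomp Require Import finmap.
From mathcomp Require Import all_classical all_reals all_analysis.
From mathcomp Require Import ring lra.
Import Order.TTheory GRing.Theory Num.Theory.
Import numFieldNormedType.Exports.
Local Open Scope classical_set_scope.
Local Open Scope ring_scope.

Section CatenoidCount.
Context {R : realType}.
Implicit Types (a b c h r u v w x y lam : R) (k : int).

(** * Squared sines and reduction modulo [pi] *)

Lemma sin_sqr_eq x y : (sin x ^+ 2 == sin y ^+ 2) = (sin (x - y) * sin (x + y) == 0).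
Proof.
suff -> : sin (x - y) * sin (x + y) = sin x ^+ 2 - sin y ^+ 2 by rewrite subr_eq0.
rewrite sinB sinD.
have := cos2Dsin2 x; have := cos2Dsin2 y.
move: (sin x) (sin y) (cos x) (cos y) => s t p q hq hp.
transitivity (s ^+ 2 * q ^+ 2 - p ^+ 2 * t ^+ 2); first by ring.
have -> : p ^+ 2 = 1 - s ^+ 2 by rewrite -hp addrK.
have -> : q ^+ 2 = 1 - t ^+ 2 by rewrite -hq addrK.
ring.
Qed.

Lemma sin_pi_int k : sin (pi * k%:~R) = 0 :> R.
Proof.
have natcase n : sin (pi *+ n) = 0 :> R.
  by elim: n => [|n IH]; rewrite ?mulr0n ?sin0// mulrSr sinDpi IH oppr0.
case: (intP k) => [|n|n]; first by rewrite mulr0 sin0.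
- by rewrite -pmulrn mulr_natr natcase.
- by rewrite mulrNz mulrN sinN -pmulrn mulr_natr natcase oppr0.
Qed.

Lemma sin_sqrBpi_int k x : sin (x - pi * k%:~R) ^+ 2 = sin x ^+ 2.
Proof. by apply/eqP; rewrite sin_sqr_eq addrAC subrr sub0r sinN sin_pi_int oppr0 mul0r. Qed.

(** Counts half-turns, because squared sines have period [pi]. *)
Definition turns x : int := Num.floor (x / pi).

Lemma turns_eq x k : (turns x == k) = (0 <= x - pi * k%:~R < pi).
Proof.
rewrite /turns floor_eq ler_pdivlMr ?pi_gt0// ltr_pdivrMr ?pi_gt0//.
by rewrite subr_ge0 ltrBlDr (mulrC pi) intrD mulrDl mul1r (addrC pi).
Qed.

Lemma residueP x : 0 <= x - pi * (turns x)%:~R < pi.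
Proof. by rewrite -turns_eq. Qed.

(** Naming the multiple of [pi] by [turns] lets bounds on [x] determine it through [turns_eq]. *)
Lemma sin_eq0 x : (sin x == 0) = (x == pi * (turns x)%:~R).
Proof.
apply/eqP/eqP => [x0|->]; last exact: sin_pi_int.
have /andP[] := residueP x; rewrite le0r subr_eq0 => /orP[/eqP//|p0 p1].
have := sin_gt0_pi (introT andP (conj p0 p1)); rewrite lt0r -sqrf_eq0.
by rewrite sin_sqrBpi_int x0 expr0n eqxx.
Qed.

Lemma sin_double_eq0 b : 0 <= b < pi -> (sin (b + b) == 0) = (b == 0) || (b == pi / 2).
Proof.
move=> /andP[b0 bpi]; rewrite sin_eq0.
have [n1|] := eqVneq (turns (b + b)) 0.
  rewrite n1 mulr0; apply/eqP/orP => [|[/eqP->|/eqP b2]]; [by left; lra|by rewrite addr0|].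
  by move/eqP: n1; rewrite turns_eq mulr0; lra.
have [n1 _|n1 n0] := eqVneq (turns (b + b)) 1.
  rewrite n1 mulr1; apply/eqP/orP => [|[/eqP b2|/eqP->]]; [by right; lra| |lra].
  by move/eqP: n1; rewrite turns_eq mulr1; lra.
have [b2|b2] := ltP b (pi / 2).
  by move: n0; rewrite turns_eq mulr0; lra.
by move: n1; rewrite turns_eq mulr1; lra.
Qed.

(** * The concave function whose zeros give the solutions with symmetric phase *)

Definition gap lam c v := lam * sin v - (v + c).

Lemma continuous_gap lam c : continuous (gap lam c).
Proof.
move=> x; apply: cvgB; last by apply: cvgD; [exact: cvg_id|exact: cvg_cst].
by apply: cvgM; [exact: cvg_cst|exact: continuous_sin].
Qed.

Lemma gap_MVT lam c x y : x < y ->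
  exists2 z, x < z < y & gap lam c y - gap lam c x = (lam * cos z - 1) * (y - x).
Proof.
move=> xy.
have [|z zxy e] := @MVT R (@sin R) (@cos R) x y xy (fun z _ => is_derive_sin z).
  exact/continuous_subspaceT/continuous_sin.
exists z; first by move: zxy; rewrite in_itv.
rewrite /gap mulrBl -mulrA -e; ring.
Qed.

(* The mean slopes on [x, y] and [y, z] are values of lam cos - 1, which is
   strictly decreasing on [0, pi]. *)
Lemma gap_gt0_between lam c x y z : 0 < lam -> 0 <= x -> x < y -> y < z -> z <= pi ->
  0 <= gap lam c x -> 0 <= gap lam c z -> 0 < gap lam c y.
Proof.
move=> lam0 x0 xy yz zpi gx gz; rewrite ltNge; apply/negP => gy.
have [s /andP[s1 s2] es] := gap_MVT lam c x y xy.
have [t /andP[t1 t2] et] := gap_MVT lam c y z yz.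
have : cos t < cos s by rewrite ltr_cos ?in_itv /=; lra.
rewrite -(ltr_pM2l lam0) => st.
have : lam * cos s - 1 <= 0 by rewrite -(pmulr_lle0 _ (_ : 0 < y - x)) -?es; lra.
have : 0 <= lam * cos t - 1 by rewrite -(pmulr_lge0 _ (_ : 0 < z - y)) -?et; lra.
lra.
Qed.

Lemma gap_IVT lam c x y : x <= y ->
  (gap lam c x <= 0 <= gap lam c y) || (gap lam c y <= 0 <= gap lam c x) ->
  exists2 z, x <= z <= y & gap lam c z = 0.
Proof.
move=> xy hs; have [||z zxy gz] := @IVT R (gap lam c) x y 0 xy.
- exact/continuous_subspaceT/continuous_gap.
- by rewrite ge_min le_max; case/orP: hs => /andP[-> ->]; rewrite ?orbT.
- by exists z => //; move: zxy; rewrite in_itv.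
Qed.

(* Pairs (u, b), with u = a h and lam = h / r. *)
Definition solutions lam : set (R * R) :=
  [set p | [/\ 0 < p.1, 0 <= p.2 < pi,
               sin (p.2 + p.1) ^+ 2 = (p.1 / lam) ^+ 2
             & sin (p.2 - p.1) ^+ 2 = (p.1 / lam) ^+ 2]].

(** For [b] in [0, pi), these are the zeros of [sin (2 b)]: the surface is then invariant under z ->
    -z. *)
Definition symmetric_phase b := (b == 0) || (b == pi / 2).

(** Requires a sign, not mere absence of zeros: its failure yields a later point with [gap]
    nonnegative, as [gap_gt0_between] needs. *)
Definition last_zero lam c v := forall w, v < w -> w <= pi -> gap lam c w < 0.

(* The first component separates the two kinds of solutions; the third one is
   meaningful only for a symmetric phase. *)
Definition code lam (p : R * R) : bool * bool * bool * int :=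
  let k := turns (p.2 + p.1) in
  if symmetric_phase p.2 then
    (true, p.2 == 0,
     `[< last_zero lam (pi * k%:~R - p.2) (p.2 + p.1 - pi * k%:~R) >], k)
  else (false, p.2 < pi / 2, false, turns (p.1 + p.1)).

(** * Equations for the two kinds of solutions *)

Lemma solutions_le lam u b : 0 < lam -> solutions lam (u, b) -> u <= lam.
Proof.
move=> lam0 [/= u0 _ e _].
have : (u / lam) ^+ 2 <= 1 by rewrite -e sin2cos2 gerBl sqr_ge0.
rewrite expr_le1//; last by rewrite divr_ge0 ?ltW.
by rewrite ler_pdivrMr// mul1r.
Qed.

Lemma asymmetric_solution lam u b : solutions lam (u, b) -> ~~ symmetric_phase b ->
  u + u = pi * (turns (u + u))%:~R.
Proof.
move=> [/= _ bpi e1 e2]; rewrite /symmetric_phase -sin_double_eq0// => nb.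
apply/eqP; rewrite -sin_eq0; have : sin (b + u) ^+ 2 == sin (b - u) ^+ 2 by rewrite e1 e2.
rewrite sin_sqr_eq (_ : b + u - (b - u) = u + u); last by ring.
by rewrite (_ : b + u + (b - u) = b + b) ?mulf_eq0 ?(negPf nb) ?orbF//; ring.
Qed.

Lemma symmetric_solution_gap lam u b (k := turns (b + u)) (v := b + u - pi * k%:~R) :
  0 < lam -> solutions lam (u, b) -> symmetric_phase b ->
  0 < v < pi /\ gap lam (pi * k%:~R - b) v = 0.
Proof.
move=> lam0 [/= u0 bpi e _] sb; have /andP[v0 vpi] := residueP (b + u).
have sv0 : 0 <= sin v by rewrite sin_ge0_pi// v0 ltW.
have : sin v ^+ 2 == (u / lam) ^+ 2 by rewrite sin_sqrBpi_int e.
rewrite eqrXn2// ?divr_ge0 ?(ltW u0) ?(ltW lam0)// => /eqP sv.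
split; last by rewrite /gap sv /v mulrC mulfVK ?gt_eqF//; ring.
rewrite vpi andbT lt_neqAle v0 andbT; apply/eqP => vE.
by move: sv; rewrite -vE sin0 => /esym/eqP; rewrite mulf_eq0 invr_eq0 !gt_eqF.
Qed.

Lemma gap_symmetric_solution lam b k v (c := pi * k%:~R - b) : 0 < lam ->
  symmetric_phase b -> 0 < v < pi -> gap lam c v = 0 ->
  solutions lam (v + c, b) /\ turns (b + (v + c)) = k.
Proof.
move=> lam0 sb vpi gv; have vcE : v + c = lam * sin v.
  by apply/eqP; rewrite eq_sym -subr_eq0; exact/eqP.
have sv := sin_gt0_pi vpi; have pi0 := pi_gt0 R.
have bE : b + (v + c) - pi * k%:~R = v by rewrite /c; ring.
split; last by apply/eqP; rewrite turns_eq bE; case/andP: vpi => /ltW -> ->.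
have quot : (v + c) / lam = sin v by rewrite vcE mulrC mulKf// gt_eqF.
split => /=; rewrite ?quot.
- by rewrite vcE mulr_gt0.
- by case/orP: sb => /eqP ->; lra.
- by rewrite -(sin_sqrBpi_int k) bE.
(* The difference of the squares has the factor [sin (2 b - k pi)], which vanishes for a symmetric
   phase. *)
- apply/eqP; rewrite sin_sqr_eq; apply/eqP.
  have -> : b - (v + c) + v = b + b - pi * k%:~R by rewrite /c; ring.
  have /eqP : sin (b + b - pi * k%:~R) ^+ 2 = 0.
    rewrite sin_sqrBpi_int; apply/eqP; rewrite sqrf_eq0 sin_double_eq0//.
    by case/orP: sb => /eqP ->; lra.
  by rewrite sqrf_eq0 => /eqP ->; rewrite mulr0.
Qed.

Lemma code_symmetric_solution lam b k v (c := pi * k%:~R - b) : 0 < lam ->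
  symmetric_phase b -> 0 < v < pi -> gap lam c v = 0 ->
  code lam (v + c, b) = (true, b == 0, `[< last_zero lam c v >], k).
Proof.
move=> lam0 sb vpi gv.
have [_ kE] := gap_symmetric_solution lam b k v lam0 sb vpi gv.
rewrite /code/= sb kE; congr (_, _, `[< last_zero _ _ _ >], _).
by rewrite /c; ring.
Qed.

(** * Injectivity of the labelling *)

Lemma code_inj lam : 0 < lam -> {in solutions lam &, injective (code lam)}.
Proof.
move=> lam0 [u b] [u' b']; rewrite !inE => s s'; rewrite /code/=.
case: ifP => sb; case: ifP => sb' //.
  have [vpi gv] := symmetric_solution_gap lam u b lam0 s sb.
  have [vpi' gv'] := symmetric_solution_gap lam u' b' lam0 s' sb'.
  move=> [b0 lz kE].
  have bb' : b = b'.
    by case/orP: sb b0 => /eqP ->; case/orP: sb' => /eqP ->; rewrite ?eqxx//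
      gt_eqF// divr_gt0// pi_gt0.
  move: vpi' gv' lz; rewrite -{}kE -{}bb'; move: vpi gv.
  set k := turns _; set c := _ - b.
  (* If [x] is last, [gap] is negative at [y]. Otherwise [y] is not last either, and a nonnegative
     value beyond [y] makes [gap] positive at [y]. *)
  have inj x y : 0 < x < pi -> gap lam c x = 0 -> 0 < y < pi -> gap lam c y = 0 ->
      `[< last_zero lam c x >] = `[< last_zero lam c y >] -> ~ x < y.
    move=> xpi gx ypi gy lz xy; have [lx|] := pselect (last_zero lam c x).
      by have := lx y xy; rewrite gy ltxx; case/andP: ypi => _ /ltW -> /(_ erefl).
    move/asboolPn; rewrite lz => /asboolPn/existsNP[w /not_implyP[yw /not_implyP[wpi]]].
    move/negP; rewrite -leNgt => gw; have x0 : 0 <= x by case/andP: xpi => /ltW.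
    have := gap_gt0_between lam c x y w lam0 x0 xy yw wpi.
    by rewrite gx gy ltxx => /(_ (lexx 0) gw).
  move=> vpi gv vpi' gv' lz; case: (ltgtP (b + u - pi * k%:~R) (b + u' - pi * k%:~R)).
  - by move/inj => []//.
  - by move/inj => []//.
  - by move/addIr/addrI => ->.
move=> [bE kE].
have uE := asymmetric_solution lam u b s (negbT sb).
have uE' := asymmetric_solution lam u' b' s' (negbT sb').
have uu' : u = u' by move: uE'; rewrite -kE -uE; lra.
subst u'; congr (_, _).
case: s s' => [/= _ bpi e _] [/= _ bpi' e' _].
(* Since [2 u] is a multiple of [pi], so is [b - b'] or [b + b']. The sum cannot be one: both phases
   lie strictly on the same side of [pi / 2]. *)
have : sin (b + u) ^+ 2 == sin (b' + u) ^+ 2 by rewrite e e'.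
rewrite sin_sqr_eq mulf_eq0 => /orP[].
  rewrite (_ : b + u - (b' + u) = b - b'); last by ring.
  (* One of the two opposite differences lies in [0, pi). *)
  have [k0|k0] := eqVneq (turns (b - b')) 0; first by rewrite sin_eq0 k0; lra.
  have [k0'|k0'] := eqVneq (turns (b' - b)) 0.
    by rewrite -oppr_eq0 -sinN opprB sin_eq0 k0'; lra.
  by move: k0 k0'; rewrite !turns_eq; lra.
have -> : b + u + (b' + u) = b + b' - pi * (- turns (u + u))%:~R.
  by rewrite mulrNz mulrN opprK -uE; ring.
rewrite -sqrf_eq0 sin_sqrBpi_int sqrf_eq0 sin_eq0 => /eqP bb'.
move: sb sb' bE; rewrite /symmetric_phase.
move=> /norP[/eqP b0 /eqP b1] /norP[/eqP b0' /eqP b1'].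
have [b2|b2] := ltP b (pi / 2) => /esym b2'.
  have k0 : turns (b + b') = 0 by apply/eqP; rewrite turns_eq; lra.
  by move: bb'; rewrite k0; lra.
have k0 : turns (b + b') = 1 by apply/eqP; rewrite turns_eq; lra.
by move: bb'; rewrite k0; lra.
Qed.

(** * Growth of the set of labels with [lam] *)

Lemma solutionsC lam u b : 0 < b -> solutions lam (u, b) -> solutions lam (u, pi - b).
Proof.
move=> b0 [/= u0 bpi e1 e2]; split => //=; first lra.
- rewrite -e2; apply/eqP; rewrite sin_sqr_eq (_ : pi - b + u + (b - u) = pi); last by ring.
  by rewrite sinpi mulr0.
- rewrite -e1; apply/eqP; rewrite sin_sqr_eq (_ : pi - b - u + (b + u) = pi); last by ring.
  by rewrite sinpi mulr0.
Qed.

Lemma sin_sqr_half x : sin x ^+ 2 = (1 - cos (x + x)) / 2.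
Proof. by rewrite -mulr2n cos_mulr2n cos2sin2; field. Qed.

(** As [sin (2 u) = 0], both equations become [cos (2 b) cos (2 u) = 1 - 2 (u / lam)^2] with
    [cos (2 u)] equal to 1 or -1, so [t = 2 b] is an arccosine. *)
Lemma asymmetric_solution_exists lam u : 0 < u -> u < lam -> sin (u + u) = 0 ->
  exists2 b, 0 < b < pi / 2 & solutions lam (u, b).
Proof.
move=> u0 ulam su; have lam0 := lt_trans u0 ulam.
set q := u / lam.
have /andP[q0 q1] : 0 < q ^+ 2 < 1.
  rewrite exprn_gt0 ?divr_gt0// expr_lt1// ?divr_ge0 ?ltW//.
  by rewrite ltr_pdivrMr ?mul1r.
have e2 : cos (u + u) ^+ 2 = 1 by rewrite cos2sin2 su expr0n subr0.
have hx : -1 < cos (u + u) * (1 - 2 * q ^+ 2) < 1.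
  by move/eqP: e2; rewrite sqrf_eq1 => /orP[]/eqP->; lra.
pose t := acos (cos (u + u) * (1 - 2 * q ^+ 2)).
have tE : cos t = cos (u + u) * (1 - 2 * q ^+ 2) by rewrite acosK// in_itv/=; lra.
have teE : cos t * cos (u + u) = 1 - 2 * q ^+ 2 by rewrite tE mulrAC -expr2 e2 mul1r.
have t0 : 0 < t by apply: acos_gt0; lra.
have tpi : t < pi by apply: acos_ltpi; lra.
exists (t / 2); first by rewrite divr_gt0//= ltr_pM2r// invr_gt0.
split => //=; first by lra.
- rewrite sin_sqr_half (_ : t / 2 + u + (t / 2 + u) = t + (u + u)); last by field.
  by rewrite cosD su mulr0 subr0 teE -/q; field.
- rewrite sin_sqr_half (_ : t / 2 - u + (t / 2 - u) = t - (u + u)); last by field.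
  by rewrite cosB su mulr0 addr0 teE -/q; field.
Qed.

Lemma code_subset lam1 lam2 : 0 < lam1 -> lam1 <= lam2 ->
  code lam1 @` solutions lam1 `<=` code lam2 @` solutions lam2.
Proof.
move=> lam1_gt0; rewrite le_eqVlt => /predU1P[->//|lam12] _ [[u b] s <-].
have lam2_gt0 := lt_trans lam1_gt0 lam12; have pi0 := pi_gt0 R.
have [sb|nb] := boolP (symmetric_phase b); last first.
  have uE := asymmetric_solution lam1 u b s nb.
  have [/= u0 bpi _ _] := s; have ulam1 := solutions_le lam1 u b lam1_gt0 s.
  (* Keep [u] and change the phase; reflection in z = 0 sends [b'] to [pi - b'] when the label asks
     for the other side of [pi / 2]. *)
  have [b' b'pi s'] : exists2 b, 0 < b < pi / 2 & solutions lam2 (u, b).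
    by apply: asymmetric_solution_exists; [|lra|rewrite uE sin_pi_int].
  have := nb; rewrite /symmetric_phase => /norP[/eqP b0 /eqP b1].
  have [b2|b2] := ltP b (pi / 2).
    exists (u, b') => //; rewrite /code/= (negPf nb) b2.
    by rewrite ifF; [congr (_, _, _, _); lra|apply/norP; split; lra].
  exists (u, pi - b'); first by apply: solutionsC => //; lra.
  rewrite /code/= (negPf nb) ifF; last by apply/norP; split; lra.
  by congr (_, _, _, _); apply/idP/idP; lra.
have [] := symmetric_solution_gap lam1 u b lam1_gt0 s sb.
set k := turns _; set v := b + u - _; set c := _ - b => vpi gv.
have uvc : u = v + c by rewrite /v /c; ring.
rewrite uvc code_symmetric_solution// -/c.
have sv := sin_gt0_pi vpi; case/andP: vpi => v0 v1.
have gv2 : 0 < gap lam2 c v.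
  have -> : gap lam2 c v = gap lam1 c v + (lam2 - lam1) * sin v by rewrite /gap; ring.
  by rewrite gv add0r mulr_gt0// subr_gt0.
suff [v' vpi' [gv' lE]] : exists2 v', 0 < v' < pi & gap lam2 c v' = 0 /\
    (last_zero lam2 c v' <-> last_zero lam1 c v).
  exists (v' + c, b); first exact: (gap_symmetric_solution lam2 b k v' lam2_gt0 sb vpi' gv').1.
  by rewrite code_symmetric_solution// -/c (asbool_equiv_eq lE).
have [lz|nlz] := pselect (last_zero lam1 c v).
  (* At [pi] the value of [gap] does not depend on [lam]; the last zero moves right, between [v] and
     [pi]. *)
  have gpi : gap lam2 c pi < 0.
    have := lz pi v1 (lexx _); rewrite /gap sinpi; lra.
  have [|v' /andP[vv' v'pi] gv'] := gap_IVT lam2 c v pi (ltW v1).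
    by rewrite (ltW gv2) (ltW gpi) orbT.
  have nv : v != v' by apply: contraTneq gv2 => ->; rewrite gv' ltxx.
  have npi : v' != pi by apply: contraTneq gpi => <-; rewrite gv' ltxx.
  exists v'; first by rewrite (lt_le_trans v0 vv') lt_neqAle npi.
  split => //; split => // _ w v'w wpi; rewrite ltNge; apply/negP => gw.
  have := gap_gt0_between lam2 c v v' w lam2_gt0 (ltW v0).
  by rewrite gv' ltxx lt_neqAle nv vv' => /(_ erefl v'w wpi (ltW gv2) gw).
have [w [vw wpi gw]] : exists w, [/\ v < w, w <= pi & 0 <= gap lam1 c w].
  move/existsNP: nlz => [w /not_implyP[vw /not_implyP[wpi /negP]]].
  by rewrite -leNgt => gw; exists w.
have g0 lam : gap lam c 0 = - c by rewrite /gap sin0; ring.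
(* Were [c <= 0], [gap lam1 c] would be nonnegative at 0 and at [w], hence positive at its zero [v].
   With [c > 0] the first zero moves left, between 0 and [v]. *)
have c0 : 0 < c.
  rewrite ltNge; apply/negP => c0.
  have := gap_gt0_between lam1 c 0 v w lam1_gt0 (lexx 0) v0 vw wpi.
  by rewrite g0 oppr_ge0 gv ltxx => /(_ c0 gw).
have [|v' /andP[v'0 vv'] gv'] := gap_IVT lam2 c 0 v (ltW v0).
  by rewrite g0 oppr_le0 (ltW gv2) (ltW c0).
have nv : v' != v by apply: contraTneq gv2 => <-; rewrite gv' ltxx.
have n0 : 0 != v'.
  by apply/eqP => v'E; move: gv'; rewrite -v'E g0; lra.
exists v'; first by rewrite lt_neqAle n0 v'0 (le_lt_trans vv' v1).
split => //; split => // /(_ v); rewrite lt_neqAle nv vv' => /(_ erefl (ltW v1)).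
by rewrite ltNge (ltW gv2).
Qed.

(** * Finiteness, lower bound, and the case [lam < 1] *)

Lemma solutions_finite lam : 0 < lam -> finite_set (solutions lam).
Proof.
move=> lam0; have pi0 := pi_gt0 R.
have fC : finite_set (code lam @` solutions lam); last first.
  have e : (code lam @` solutions lam #= solutions lam)%card by apply/inj_card_eq/code_inj.
  by rewrite -(eq_finite_set e).
(* [lam + lam + pi] bounds both [b + u] and [u + u], whose half-turns the labels record. *)
pose M := `|turns (lam + lam + pi)|%N.
apply: (@sub_finite_set _ _ ([set: bool * bool * bool] `*` (Posz @` `I_M.+1))); last first.
  by apply: finite_setX; [exact: finite_finset|exact/finite_image/finite_II].
have bound x : 0 <= x -> x <= lam + lam + pi ->
    exists2 n : nat, (n < M.+1)%N & Posz n = turns x.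
  move=> x0 xM; have t0 y : 0 <= y -> 0 <= turns y.
    by move=> y0; rewrite /turns floor_ge0 divr_ge0// ltW.
  exists `|turns x|%N; last by rewrite gez0_abs// t0.
  rewrite ltnS -lez_nat !gez0_abs ?t0//; last lra.
  by rewrite /turns le_floor// ler_pM2r// invr_gt0.
move=> _ [[u b] s <-]; have ulam := solutions_le lam u b lam0 s.
have [/= u0 bpi _ _] := s.
rewrite /code/=; case: ifP => _; split => //=; apply: bound; lra.
Qed.

Lemma solutions_card_ge n lam : pi * n%:R < lam -> (`I_n #<= solutions lam)%card.
Proof.
move=> nlam; have pi0 := pi_gt0 R.
have ex i : exists b, (i < n)%N -> solutions lam (pi / 2 * i.+1%:R, b).
  (* The shift to [i.+1] keeps [u] positive; beyond [n] the phase 0 is a mere default. *)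
  have [iltn|] := ltnP i n; last by exists 0.
  have iM : i.+1%:R <= n%:R :> R by rewrite ler_nat.
  have i0 : 0 < pi / 2 * i.+1%:R :> R by rewrite mulr_gt0// divr_gt0.
  have [||b _ s] := asymmetric_solution_exists lam (pi / 2 * i.+1%:R) i0; last by exists b.
    apply: le_lt_trans nlam; rewrite ler_pM// ?divr_ge0 ?ltW//; lra.
  have -> : pi / 2 * i.+1%:R + pi / 2 * i.+1%:R = pi * (Posz i.+1)%:~R :> R.
    by rewrite -pmulrn; field.
  exact: sin_pi_int.
have [b sb] := choice ex.
pose f (i : nat) : R * R := (pi / 2 * i.+1%:R, b i).
have fE : (f @` `I_n #= `I_n)%card.
  apply: inj_card_eq => i j _ _ [/(mulfI _)].
  by rewrite gt_eqF ?divr_gt0// => /(_ erefl)/eqP; rewrite eqr_nat => /eqP[].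
rewrite -(card_le_eql fE); apply: subset_card_le => _ [i ilt <-]; exact: sb.
Qed.

(** Here [u <= lam < 1 <= pi / 2]: [2 u < pi] excludes asymmetric phases, and [b + u < pi] for
    symmetric ones leaves zero half-turns. *)
Lemma solutions_small lam : 0 < lam -> lam < 1 ->
  code lam @` solutions lam = [set (true, false, true, 0)].
Proof.
move=> lam0 lam1; have pi2 := pi_ge2 R.
have pih0 : (pi / 2 == 0 :> R) = false by rewrite gt_eqF// divr_gt0// pi_gt0.
pose c : R := pi * (0 : int)%:~R - pi / 2.
have cE : c = - (pi / 2) by rewrite /c mulr0 sub0r.
have sb : symmetric_phase (pi / 2) by rewrite /symmetric_phase eqxx orbT.
(* As [c < 0], [gap] is positive at 0, so concavity forbids a nonnegative value after a positive
   zero. *)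
have lastc v : 0 < v -> gap lam c v = 0 -> last_zero lam c v.
  move=> v0 gv w vw wpi; rewrite ltNge; apply/negP => gw.
  have g0 : 0 <= gap lam c 0 by rewrite /gap sin0; lra.
  by have := gap_gt0_between lam c 0 v w lam0 (lexx 0) v0 vw wpi g0 gw; rewrite gv ltxx.
apply/seteqP; split => [_ [[u b] s <-]|_ ->]; last first.
  have [|v /andP[v0 vpi] gv] := gap_IVT lam c 0 pi (pi_ge0 R).
    by rewrite /gap sin0 sinpi; lra.
  have v0' : 0 != v by apply/eqP => v0'; move: gv; rewrite -v0' /gap sin0; lra.
  have vpi' : v != pi by apply/eqP => vpi'; move: gv; rewrite vpi' /gap sinpi; lra.
  have v01 : 0 < v < pi by rewrite !lt_neqAle v0' v0 vpi' vpi.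
  exists (v + c, pi / 2); first exact: (gap_symmetric_solution lam _ 0 v lam0 sb v01 gv).1.
  rewrite code_symmetric_solution// pih0; congr (_, _, _, _).
  by apply/asboolP/lastc => //; case/andP: v01.
have ulam := solutions_le lam u b lam0 s; have [/= u0 bpi _ _] := s.
have [sb'|nb] := boolP (symmetric_phase b); last first.
  have uE := asymmetric_solution lam u b s nb.
  have : turns (u + u) = 0 by apply/eqP; rewrite turns_eq; lra.
  by move=> k0; exfalso; move: uE; rewrite k0; lra.
have k0 : turns (b + u) = 0.
  by apply/eqP; rewrite turns_eq; case/orP: sb' => /eqP ->; lra.
have [] := symmetric_solution_gap lam u b lam0 s sb'.
rewrite k0 /code/= sb' k0 mulr0 subr0 sub0r => vpi gv.
case/orP: sb' => /eqP bE; subst b.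
  (* Phase 0: the mean slope on [0, u] would vanish, giving [lam * cos z = 1]. *)
  move: gv; rewrite oppr0 add0r => gv; have [z _] := gap_MVT lam 0 0 u u0.
  rewrite gv /gap sin0 !(mulr0, addr0, subr0) => /esym/eqP.
  rewrite mulf_eq0 (gt_eqF u0) orbF subr_eq0 => /eqP lz.
  have : lam * cos z <= lam by rewrite ler_piMr ?cos_le1 ?ltW.
  by rewrite lz leNgt lam1.
rewrite pih0; congr (_, _, _, _).
by apply/asboolP; rewrite -cE; apply: lastc; [lra|rewrite cE].
Qed.

(** * From catenoids to solutions *)

Lemma polar_exists x y r : x ^+ 2 + y ^+ 2 = r ^+ 2 ->
  exists t, x = r * cos t /\ y = r * sin t.
Proof.
have [->|r0] := eqVneq r 0.
  move/eqP; rewrite expr0n paddr_eq0 ?sqr_ge0// !sqrf_eq0 => /andP[/eqP -> /eqP ->].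
  by exists 0; rewrite !mul0r.
move=> e; have e1 : (x / r) ^+ 2 + (y / r) ^+ 2 = 1.
  by rewrite !expr_div_n -mulrDl e divff// expf_neq0.
have x1 : -1 <= x / r <= 1.
  by rewrite -ler_norml -(expr_le1 (n := 2))// real_normK ?num_real// -e1 lerDl sqr_ge0.
have ct : cos (acos (x / r)) = x / r by rewrite acosK// in_itv/=.
have : (y / r) ^+ 2 == sin (acos (x / r)) ^+ 2.
  by rewrite sin2cos2 ct -e1 addrC addKr.
rewrite eqf_sqr => /orP[/eqP yE|/eqP yE].
  by exists (acos (x / r)); rewrite ct -yE !(mulrC r) !mulfVK.
by exists (- acos (x / r)); rewrite cosN sinN ct -yE !(mulrC r) !mulfVK.
Qed.

Lemma catenoidE a b : catenoid a b =
  [set p | p.1.1 ^+ 2 + p.1.2 ^+ 2 = profile a b p.2 ^+ 2].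
Proof.
apply/seteqP; split => [_ [[s t] _ <-]|[[x y] z] /= /polar_exists [t [-> ->]]] /=.
  by rewrite !exprMn -mulrDr cos2Dsin2 mulr1.
by exists (z, t).
Qed.

Lemma circle_sub_catenoid r a b z :
  circle r z `<=` catenoid a b <-> profile a b z ^+ 2 = r ^+ 2.
Proof.
rewrite catenoidE; split=> [cz|e [[x y] _] [/= -> ->]]; last by rewrite e.
have := cz (r, 0, z).
by rewrite /circle/= expr0n addr0 => /(_ (conj erefl erefl)) <-.
Qed.

Lemma profile_sqr_eq a b r z : a != 0 ->
  (profile a b z ^+ 2 == r ^+ 2) = (sin (b + a * z) ^+ 2 == (a * r) ^+ 2).
Proof.
move=> a0; rewrite /profile !exprMn exprVn (addrC b).
by rewrite -(inj_eq (mulfI (expf_neq0 2 a0))) mulVKf ?expf_neq0.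
Qed.

(** With [catenoid_phase_reduction], this normalises the parameters to [a > 0] and [0 <= b < pi]. *)
Lemma catenoidN a b : catenoid (- a) b = catenoid a (- b).
Proof.
rewrite !catenoidE; apply/funext => p /=; congr (_ = _ ^+ 2).
by rewrite /profile invrN !mulNr -mulrN -sinN opprD opprK.
Qed.

Lemma catenoid_phase_reduction a b : catenoid a (b - pi * (turns b)%:~R) = catenoid a b.
Proof.
rewrite !catenoidE; apply/funext => p /=; congr (_ = _).
by rewrite /profile !exprMn addrA sin_sqrBpi_int.
Qed.

(** The maximal radius [1 / a] determines [a], and then a point of the axis determines [b] modulo
    [pi]. *)
Lemma catenoid_inj a1 b1 a2 b2 : 0 < a1 -> 0 < a2 -> 0 <= b1 < pi -> 0 <= b2 < pi ->
  catenoid a1 b1 = catenoid a2 b2 -> (a1, b1) = (a2, b2).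
Proof.
have amplitude a b a' b' : 0 < a -> 0 < a' ->
    (forall z, profile a b z ^+ 2 = profile a' b' z ^+ 2) -> a' <= a.
  (* The height where the first profile attains its maximum [1 / a]. *)
  move=> a0 a'0 e; have := e ((pi / 2 - b) / a).
  rewrite /profile (mulrC a) mulfVK ?gt_eqF// subrK sin_pihalf mulr1 exprMn => {}e.
  rewrite -lef_pV2// -(ler_pXn2r (n := 2)) ?nnegrE ?invr_ge0 ?(ltW a0) ?(ltW a'0)// e.
  apply: ler_piMr; first exact: sqr_ge0.
  by rewrite sin2cos2 gerBl sqr_ge0.
move=> a10 a20 b1pi b2pi; rewrite !catenoidE => e.
have {}e z : profile a1 b1 z ^+ 2 = profile a2 b2 z ^+ 2.
  have : [set p : R * R * R | p.1.1 ^+ 2 + p.1.2 ^+ 2 = profile a1 b1 p.2 ^+ 2]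
      (profile a1 b1 z, 0, z) by rewrite /= expr0n addr0.
  by rewrite e /= expr0n addr0.
have aE : a1 = a2.
  apply/eqP; rewrite eq_le (amplitude a1 b1 a2 b2)// (amplitude a2 b2 a1 b1)//.
rewrite -{}aE in e *; congr (_, _).
have /esym/eqP := e (- b1 / a1); rewrite /profile (mulrC a1) mulfVK ?(gt_eqF a10)//.
rewrite addNr sin0 mulr0 expr0n/= sqrf_eq0 mulf_eq0 invr_eq0 (gt_eqF a10)/=.
have [k0|k0] := eqVneq (turns (- b1 + b2)) 0; first by rewrite sin_eq0 k0; lra.
have [k0'|k0'] := eqVneq (turns (b1 - b2)) 0.
  by rewrite -oppr_eq0 -sinN opprD opprK sin_eq0 k0'; lra.
by move: k0 k0'; rewrite !turns_eq; lra.
Qed.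

(** With [a = u / h] and [lam = h / r], [a r] is [u / lam]; the circles at [h] and [- h] give the
    two equations. *)
Lemma connecting_catenoidsE r h : 0 < r -> 0 < h ->
  connecting_catenoids r h =
  (fun p => catenoid (p.1 / h) p.2) @` solutions (h / r).
Proof.
move=> r0 h0; apply/seteqP; split => [S [[a [b [a0 ->]]]]|_ [[u b] s <-] /=].
  wlog a_gt0 : a b a0 / 0 < a.
    move=> pos; have [/pos|] := ltP 0 a; first exact.
    rewrite le_eqVlt (negPf a0)/= => an.
    rewrite (_ : catenoid a b = catenoid (- a) (- b)); last by rewrite -catenoidN opprK.
    by apply: pos; rewrite ?oppr_eq0 ?oppr_gt0.
  rewrite !circle_sub_catenoid -catenoid_phase_reduction.
  move=> /eqP em /eqP ep; exists (a * h, b - pi * (turns b)%:~R); last first.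
    by rewrite /= mulfK ?gt_eqF.
  have uE : a * h / (h / r) = a * r by field; rewrite !gt_eqF.
  split => /=; rewrite ?uE ?residueP ?mulr_gt0//.
  - by move: ep; rewrite profile_sqr_eq// addrAC sin_sqrBpi_int => /eqP.
  - by move: em; rewrite profile_sqr_eq// mulrN addrAC sin_sqrBpi_int => /eqP.
case: s => /= u0 bpi e1 e2; have a0 : u / h != 0 by rewrite gt_eqF ?divr_gt0.
have uE : u / (h / r) = u / h * r by field; rewrite !gt_eqF.
split; first by exists (u / h), b.
- by apply/circle_sub_catenoid/eqP; rewrite profile_sqr_eq// mulrN mulfVK ?(gt_eqF h0)// e2 uE.
- by apply/circle_sub_catenoid/eqP; rewrite profile_sqr_eq// mulfVK ?(gt_eqF h0)// e1 uE.
Qed.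

Lemma connecting_catenoids_card r h : 0 < r -> 0 < h ->
  (connecting_catenoids r h #= solutions (h / r))%card.
Proof.
move=> r0 h0; rewrite connecting_catenoidsE//; apply: inj_card_eq.
move=> [u b] [u' b']; rewrite !inE => -[/= u0 bpi _ _] [/= u0' bpi' _ _].
move=> /(catenoid_inj _ _ _ _ (divr_gt0 u0 h0) (divr_gt0 u0' h0) bpi bpi')[/mulIf uE ->].
by rewrite uE// invr_neq0// gt_eqF.
Qed.

Lemma connecting_catenoids_finite r h : 0 < r -> 0 < h ->
  finite_set (connecting_catenoids r h).
Proof.
move=> r0 h0; rewrite (eq_finite_set (connecting_catenoids_card r h r0 h0)).
by apply: solutions_finite; rewrite divr_gt0.
Qed.

(** Counting labels makes monotonicity an inclusion, since label sets for different [h] are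
    nested. *)
Lemma catenoid_countE r h : 0 < r -> 0 < h ->
  catenoid_count r h = #|` fset_set (code (h / r) @` solutions (h / r))|%fset.
Proof.
move=> r0 h0; have lam0 : 0 < h / r by rewrite divr_gt0.
have fin := solutions_finite (h / r) lam0.
apply/fcard_eq; [exact: connecting_catenoids_finite|exact: finite_image|].
apply: (card_eq_trans (connecting_catenoids_card r h r0 h0)).
by rewrite card_eq_sym; apply/inj_card_eq/code_inj.
Qed.

End CatenoidCount.

Theorem theorem3p4 (R : realType) (r : R) (hr : 0 < r) :
  [/\ forall h : R, 0 < h -> finite_set (connecting_catenoids r h),
      forall h1 h2 : R, 0 < h1 -> h1 <= h2 ->
        (catenoid_count r h1 <= catenoid_count r h2)%N,
      catenoid_count r h @[h --> +oo] --> \oo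
    & exists c0 : R, 0 < c0 /\
        forall h : R, 0 < h -> h / r < c0 -> catenoid_count r h = 1%N].
Proof.
split.
- by move=> h; exact: connecting_catenoids_finite.
- move=> h1 h2 h10 h12; have h20 := lt_le_trans h10 h12.
  rewrite !catenoid_countE//; apply: fsubset_leq_card.
  rewrite -fset_set_sub; try by apply: finite_image; apply: solutions_finite; rewrite divr_gt0.
  by apply: code_subset; rewrite ?divr_gt0// ler_pM2r ?invr_gt0.
- apply/cvgnyPge => n; near=> h.
  have h0 : 0 < h by near: h; exact/nbhs_pinfty_gt/num_real.
  apply: leq_card_fset_set; first exact: connecting_catenoids_finite.
  rewrite (card_le_eqr (connecting_catenoids_card r h hr h0)).
  apply: solutions_card_ge; rewrite ltr_pdivlMr//.
  by near: h; exact/nbhs_pinfty_gt/num_real.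
(* The bound 1 on [h / r] is that of [solutions_small]. *)
- exists 1; split => // h h0 hr1; rewrite catenoid_countE// solutions_small ?divr_gt0//.
  by rewrite fset_set1 cardfs1.
Unshelve. all: by end_near.
Qed.
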